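(* Let $K$ be a field, $A=K[x_1,\ldots,x_s]$, $B=K[y_1,\ldots,y_t]$ and $R=A\otimes_K B=K[x_1,\ldots,x_s,y_1,\ldots,y_t]$. Let $I$ be a square-free monomial ideal of $A$ and let $J$ be a monomial ideal of $B$. Assume that $I$ is normally torsion-free. Then, for all $n\geqslant 1$, $$\overline{(I+J)^n}=\sum_{i=0}^n I^i\,\overline{J^{n-i}}$$ as ideals of $R$.
   Context: The variables $x_1,\ldots,x_s$ and $y_1,\ldots,y_t$ are disjoint. Ideals of $A$ and of $B$ are identified with their extensions to $R$ and denoted by the same symbols; the zeroth power of an ideal is the whole ring. The integral closure $\overline{J}$ of an ideal $J$ of a ring is the ideal of all elements $x$ of the ring satisfying an equation $x^n+a_1x^{n-1}+\cdots+a_{n-1}x+a_n=0$ with $n\geqslant 1$ and $a_i\in J^i$ for $i=1,\ldots,n$. For a square-free monomial ideal $I$ and $n\geqslant 1$, the $n$-th symbolic power is $I^{(n)}=\bigcap_{\mathfrak p}\mathfrak p^n$, where $\mathfrak p$ ranges over the minimal primes of $I$ (each generated by variables). The ideal $I$ is normally torsion-free if $I^{(n)}=I^n$ for all $n\geqslant 1$. *)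

(* Defs.v *)
From HB Require Import structures.
From mathcomp Require Import all_boot all_order all_algebra.
From mathcomp Require Export mpoly.
From mathcomp Require Export boolp classical_sets.

Set Implicit Arguments.
Unset Strict Implicit.
Unset Printing Implicit Defensive.

Import GRing.Theory.

Local Open Scope classical_set_scope.
Local Open Scope ring_scope.

Section Ideals.
Variable R : comNzRingType.
Implicit Types (I J P : set R) (G : set R).

(* Unlike MathComp's [idealr], which is boolean and proper, the unit ideal is
   allowed here. *)
Definition is_ideal I : Prop :=
  [/\ I 0, forall x y, I x -> I y -> I (x + y) & forall a x, I x -> I (a * x)].

Definition ideal_gen G : set R := smallest is_ideal G.

Definition ideal_add I J : set R := [set x + y | x in I & y in J].

Definition ideal_mul I J : set R := ideal_gen [set x * y | x in I & y in J].

Fixpoint ideal_pow I (n : nat) : set R :=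
  if n is m.+1 then ideal_mul I (ideal_pow I m) else setT.

Definition integral_closure J : set R :=
  [set x | exists n : nat, exists a : nat -> R,
    [/\ (1 <= n)%N,
        forall i, (1 <= i <= n)%N -> ideal_pow J i (a i) &
        x ^+ n + \sum_(1 <= i < n.+1) a i * x ^+ (n - i) = 0]].

Definition is_prime_ideal P : Prop :=
  [/\ is_ideal P, ~ P 1 & forall x y, P (x * y) -> P x \/ P y].

Definition minimal_primes I : set (set R) :=
  [set P | [/\ is_prime_ideal P, I `<=` P &
    forall Q, is_prime_ideal Q -> I `<=` Q -> Q `<=` P -> Q = P]].

(* This agrees with the usual symbolic power for square-free monomial ideals (more
   generally, radical ones whose minimal primes have primary powers). If I is
   the unit ideal, the intersection is empty and the result is the whole ring. *)
Definition symbolic_power I (n : nat) : set R :=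
  \bigcap_(P in minimal_primes I) ideal_pow P n.

Definition normally_torsion_free I : Prop :=
  forall n : nat, (1 <= n)%N -> symbolic_power I n = ideal_pow I n.

End Ideals.

(* The empty set of generators (zero ideal) and the monomial 1 (unit ideal) are
   both allowed. *)
Definition monomial_ideal (K : fieldType) (n : nat) (I : set {mpoly K[n]}) :
    Prop :=
  exists S : set 'X_{1..n}, I = ideal_gen [set 'X_[m] | m in S].

Definition squarefree_monomial_ideal (K : fieldType) (n : nat)
    (I : set {mpoly K[n]}) : Prop :=
  exists S : set 'X_{1..n},
    (forall m, S m -> forall i, (m i <= 1)%N) /\
    I = ideal_gen [set 'X_[m] | m in S].

(* In {mpoly K[s + t]}, the variables with index lshift t i are x_1, ..., x_s
   and those with index rshift s j are y_1, ..., y_t. *)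
Section Extension.
Variables (K : fieldType) (s t : nat).

Definition embA (p : {mpoly K[s]}) : {mpoly K[s + t]} :=
  p \mPo [tuple 'X_(lshift t i) | i < s].

Definition embB (p : {mpoly K[t]}) : {mpoly K[s + t]} :=
  p \mPo [tuple 'X_(rshift s j) | j < t].

Definition extA (I : set {mpoly K[s]}) : set {mpoly K[s + t]} :=
  ideal_gen [set embA p | p in I].

Definition extB (J : set {mpoly K[t]}) : set {mpoly K[s + t]} :=
  ideal_gen [set embB p | p in J].

End Extension.

Arguments extA {K s} t I.
Arguments extB {K} s {t} J.

(* Main.v *)
Require Import Defs.
From HB Require Import structures.
From mathcomp Require Import all_boot all_order all_algebra.
From mathcomp Require Import mpoly boolp classical_sets.
From mathcomp Require Import zify ring.

Set Implicit Arguments.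
Unset Strict Implicit.
Unset Printing Implicit Defensive.

Import GRing.Theory.

Local Open Scope classical_set_scope.
Local Open Scope ring_scope.

(** All the ideals in the theorem are monomial, so that it reduces to an identity
    between sets of exponents. A monomial ideal is written [mono_ideal R E], the set
    of polynomials supported in a set [E] of exponents stable under adding exponents
    ([up_closed]); sums, products, powers and extensions to more variables then
    become operations on [E].

    The one step which is not formal is the integral closure
    ([integral_closure_mono_ideal]): it consists of the polynomials all of whose
    monomials X^m satisfy X^(km) in the k-th power of the ideal for some k >= 1.
    One inclusion needs integral closures to be stable under sums; this follows from
    [integral_closureP], by which x is integral over J exactly when xT is integral
    over the Rees algebra R[JT]. For the other inclusion one has to see that the
    monomials of an integral element f are integral. After adjoining a variable T to
    the coefficients, the substitutions X_i -> T X_i preserve the ideal, and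
    they have the monomials as eigenvectors with enough distinct eigenvalues to
    extract from f a nonzero multiple of each of its monomials
    ([isolate_monomial]). For a single monomial, comparing coefficients in the
    equation of integral dependence suffices ([integral_monomial_exp]).

    Let then X^a Y^b be integral over (I + J)^n. Some power X^(ka) Y^(kb) lies in
    (I + J)^(nk), hence in I^i J^(nk-i) for some i. The minimal primes of I are
    generated by variables, so that X^(ka) in I^i forces the degree of X^a in the
    variables of each of them to be at least i/k, hence at least c, the ceiling of
    i/k. Thus X^a lies in the c-th symbolic power of I, which is I^c by hypothesis
    ([normally_torsion_free_exp]). As i <= ck, the monomial Y^(kb) lies in
    J^(k(n-c)), so that Y^b is integral over J^(n-c), and X^a Y^b lies in the term of
    index c on the right. The reverse inclusion raises a product of monomials of
    I^i and of the closure of J^(n-i) to a suitable power. Both are carried out in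
    [exp_closure_blocks]. *)

(** * Ideals and their powers *)

Section IdealTheory.
Variable R : comNzRingType.
Implicit Types (I J P G : set R).

Lemma ideal_gen_ideal G : is_ideal (ideal_gen G).
Proof.
split=> [P [[P0 _ _] _] //|x y gx gy P PP|a x gx P PP].
  by have [[_ PD _] _] := PP; apply: PD; [apply: gx|apply: gy].
by have [[_ _ PM] _] := PP; apply: PM; apply: gx.
Qed.

Lemma ideal_gen_min G I : is_ideal I -> G `<=` I -> ideal_gen G `<=` I.
Proof. exact: smallest_sub. Qed.

Lemma mem_ideal_gen G x : G x -> ideal_gen G x.
Proof. exact: sub_gen_smallest. Qed.

Lemma ideal_sum I (T : eqType) (r : seq T) (P : pred T) (F : T -> R) :
  is_ideal I -> (forall i, i \in r -> P i -> I (F i)) -> I (\sum_(i <- r | P i) F i).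
Proof.
move=> [I0 ID _] IF; rewrite big_seq_cond; apply: big_ind => // i /andP[].
exact: IF.
Qed.

Lemma idealN I x : is_ideal I -> I x -> I (- x).
Proof. by move=> [_ _ IM] Ix; rewrite -mulN1r; apply: IM. Qed.

Lemma ideal_pow_ideal I n : is_ideal (ideal_pow I n).
Proof. by case: n => [|n] //=; apply: ideal_gen_ideal. Qed.

Lemma ideal_mulP I J x y : I x -> J y -> ideal_mul I J (x * y).
Proof. by move=> Ix Jy; apply: mem_ideal_gen; exists x => //; exists y. Qed.

Lemma ideal_mul_min I J P : is_ideal P ->
  (forall x y, I x -> J y -> P (x * y)) -> ideal_mul I J `<=` P.
Proof.
by move=> iP h; apply: ideal_gen_min => // _ [x Ix [y Jy <-]]; apply: h.
Qed.

(** The colon ideal of [P] by [y]: it turns a statement about products [x * y]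
    into one about membership of [x] in an ideal, so that [ideal_mul_min]
    applies. *)
Lemma ideal_divr_ideal P (y : R) : is_ideal P -> is_ideal [set x | P (x * y)].
Proof.
move=> [P0 PD PM]; split=> [|u v /= Pu Pv|u v /= Pv]; rewrite /= ?mul0r ?mulrDl //.
  exact: PD.
by rewrite -mulrA; apply: PM.
Qed.

Lemma ideal_powD I a b x y :
  ideal_pow I a x -> ideal_pow I b y -> ideal_pow I (a + b) (x * y).
Proof.
elim: a x => [|a IHa] x Ix Iy; first by have [_ _] := ideal_pow_ideal I b; apply.
suff: ideal_mul I (ideal_pow I a)
    `<=` [set x | ideal_pow I (a.+1 + b) (x * y)] by apply.
apply: ideal_mul_min; first exact/ideal_divr_ideal/ideal_pow_ideal.
by move=> u v Iu Iv /=; rewrite -mulrA; apply: ideal_mulP => //; apply: IHa.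
Qed.

End IdealTheory.

Section Morphism.
Variables (R S : comNzRingType) (f : {rmorphism R -> S}).
Implicit Types (I : set R) (J : set S).

Lemma ideal_preim J : is_ideal J -> is_ideal (f @^-1` J).
Proof.
move=> [J0 JD JM]; split=> [|x y /= Jx Jy|a x /= Jx];
  rewrite /= ?raddf0 ?raddfD ?rmorphM //.
  exact: JD.
exact: JM.
Qed.

Lemma ideal_pow_morph I J n : (forall x, I x -> J (f x)) ->
  forall x, ideal_pow I n x -> ideal_pow J n (f x).
Proof.
move=> IJ; elim: n => [|n IHn] //=.
apply: ideal_mul_min; first exact/ideal_preim/ideal_gen_ideal.
move=> u v Iu Iv /=; rewrite rmorphM; apply: ideal_mulP; [exact: IJ|exact: IHn].
Qed.

Lemma integral_closure_morph I J : (forall x, I x -> J (f x)) ->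
  forall x, integral_closure I x -> integral_closure J (f x).
Proof.
move=> IJ x [n [a [n0 Ia e]]]; exists n, (f \o a); split=> // [i hi|].
  by apply: (ideal_pow_morph IJ); apply: Ia.
rewrite -[RHS](rmorph0 f) -e rmorphD rmorph_sum rmorphXn; congr (_ + _).
by apply: eq_bigr => i _; rewrite rmorphM rmorphXn.
Qed.

End Morphism.

(** * Integral closure through the Rees algebra *)

Section Rees.
Variables (R : comNzRingType) (J : set R).

(** The Rees algebra R[JT], as the polynomials whose coefficient of T^i lies in
    J^i. It is built as a ring in order to use the theorem that sums of integral
    elements are integral. *)
Definition rees_pred : {pred {poly R}} :=
  fun p => `[< forall i, ideal_pow J i p`_i >].

Lemma rees_predP (p : {poly R}) :
  reflect (forall i, ideal_pow J i p`_i) (p \in rees_pred).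
Proof. exact: asboolP. Qed.

Lemma rees_subring_closed : subring_closed rees_pred.
Proof.
split=> [|p q /rees_predP Jp /rees_predP Jq|p q /rees_predP Jp /rees_predP Jq];
  apply/rees_predP=> i; have iJ := ideal_pow_ideal J i; have [J0 JD _] := iJ.
- by rewrite coef1; case: i iJ J0 {JD} => [|i].
- by rewrite coefB; apply: JD => //; apply: idealN.
rewrite coefM; apply: ideal_sum => // j _ _.
have := ideal_powD (Jp j) (Jq (i - j)%N).
by rewrite subnKC // -ltnS.
Qed.

HB.instance Definition _ := GRing.isSubringClosed.Build _ rees_pred
  rees_subring_closed.

Record rees := Rees { rees_val : {poly R}; _ : rees_val \in rees_pred }.
HB.instance Definition _ := [isSub for rees_val].
HB.instance Definition _ := [Choice of rees by <:].
HB.instance Definition _ := [SubChoice_isSubComNzRing of rees by <:].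

(** A name for the projection with its morphism structure attached;
    [/=] reduces a bare [\val] to [rees_val], on which the lemmas on morphisms
    no longer match. *)
Definition rees_inj : {rmorphism rees -> {poly R}} := \val.

Lemma rees_inj_inj : injective rees_inj.
Proof. exact: val_inj. Qed.

Let lead1 (p : {poly rees}) n : p`_n = 1 -> (map_poly rees_inj p)`_n = 1.
Proof. by move=> pn; rewrite coef_map [p`_n]pn; apply: rmorph1. Qed.

(** An equation of integral dependence of x over J, multiplied by T^n, is a monic
    equation of xT over R[JT]. Conversely, a monic equation of degree n for xT
    over R[JT] gives one for x over J by taking the coefficients of T^n. *)
Lemma integral_closureP x :
  integral_closure J x <-> integralOver rees_inj (x *: 'X).
Proof.
split=> [[n [a [n0 Ja e]]]|[p mp rp]].
  (* b i is the coefficient of Y^(n - i) in the equation satisfied by xT;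
     the zero beyond n only serves to make b total *)
  pose b (i : nat) : {poly R} := if i == 0%N then 1 else
    if (i <= n)%N then a i *: 'X^i else 0.
  have Pb i : b i \in rees_pred.
    apply/rees_predP=> k; rewrite /b; case: eqP => [_|/eqP i0].
      by have /rees_predP := rpred1 rees_pred; apply.
    case: ifP => [lin|_]; last by rewrite coef0; case: (ideal_pow_ideal J k).
    rewrite coefZ coefXn; case: eqP => [->|_].
      by rewrite mulr1; apply: Ja; rewrite lt0n i0.
    by rewrite mulr0; case: (ideal_pow_ideal J k).
  pose p : {poly rees} := \poly_(i < n.+1) Rees (Pb (n - i)%N).
  have pn : p`_n = 1 by rewrite coef_poly ltnSn; apply: val_inj; rewrite /= subnn.
  have sp : size p = n.+1.
    by apply: size_poly_eq; rewrite subnn -val_eqE /= /b /= oner_eq0.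
  exists p; first by rewrite monicE lead_coefE sp pn.
  rewrite /root horner_coef size_map_inj_poly ?raddf0 //; last exact: rees_inj_inj.
  rewrite sp big_ord_recr [_`_ord_max](lead1 pn) mul1r.
  suff -> : \sum_(i < n) (map_poly rees_inj p)`_i * (x *: 'X) ^+ i =
      (\sum_(1 <= i < n.+1) a i * x ^+ (n - i)) *: 'X^n.
    rewrite exprZn /= -scalerDl addrC e scale0r //.
  rewrite big_add1 succnK big_mkord (reindex_inj rev_ord_inj) scaler_suml.
  apply: eq_bigr => i _.
  have lin : (n - i.+1 <= n)%N by rewrite leq_subr.
    rewrite coef_map coef_poly ltnS lin /= subKn // /b /= ltn_ord exprZn.
  by rewrite -scalerAl -scalerAr scalerA -exprD subnKC.
have [n sp] : exists n, size p = n.+1.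
  by exists (size p).-1; rewrite prednK // size_poly_gt0 monic_neq0.
have pn : p`_n = 1 by move/monicP: mp; rewrite lead_coefE sp.
have: (map_poly rees_inj p).[x *: 'X]`_n = 0.
  by move/eqP: rp => ->; rewrite coef0.
rewrite horner_coef size_map_inj_poly ?raddf0 //; last exact: rees_inj_inj.
rewrite sp coef_sum big_ord_recr [_`_ord_max](lead1 pn) mul1r exprZn.
rewrite coefZ coefXn eqxx mulr1.
have [->|n0] := posnP n.
  by rewrite big_ord0 /= add0r expr0 => /eqP; rewrite oner_eq0.
move=> e; exists n, (fun i => (val p`_(n - i))`_i); split=> // [i _|].
  by have /rees_predP := valP p`_(n - i)%N; apply.
rewrite addrC -[RHS]e; congr (_ + _).
rewrite big_add1 succnK big_mkord (reindex_inj rev_ord_inj).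
apply: eq_bigr => i _; rewrite [rev_ord i : nat]/= subnSK // subKn 1?ltnW //.
by rewrite coef_map /= exprZn -scalerAr coefZ coefMXn ltnNge [(i <= n)%N]ltnW //= mulrC.
Qed.

(** Stability under sums is the point: it is obtained from the integral elements
    over the Rees algebra. *)
Lemma integral_closure_ideal : is_ideal (integral_closure J).
Proof.
split=> [|x y|a x].
- by apply/integral_closureP; rewrite scale0r; apply: integral0.
- move=> /integral_closureP ix /integral_closureP iy; apply/integral_closureP.
  by rewrite scalerDl; apply: integral_add.
move=> [n [c [n0 Jc e]]]; exists n, (fun i => a ^+ i * c i); split=> // [i hi|].
  by have [_ _] := ideal_pow_ideal J i; apply; apply: Jc.
rewrite -[RHS](mulr0 (a ^+ n)) -[in RHS]e mulrDr exprMn mulr_sumr; congr (_ + _).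
rewrite [LHS]big_nat_cond [RHS]big_nat_cond; apply: eq_bigr => i /andP[/andP[_ lin] _].
by rewrite exprMn -{3}(subnKC (lin : (i <= n)%N)) exprD; ring.
Qed.

End Rees.

(** * Arithmetic of sets of exponents *)

Section ExponentSets.
Variable n : nat.
Implicit Types (E F : set 'X_{1..n}) (m : 'X_{1..n}).

Definition up_closed E := forall m m', E m -> E (m + m')%MM.

Definition exp_add E F : set 'X_{1..n} := [set (m1 + m2)%MM | m1 in E & m2 in F].

Fixpoint exp_pow E (k : nat) : set 'X_{1..n} :=
  if k is l.+1 then exp_add E (exp_pow E l) else setT.

(** If [E] is the set of exponents of a monomial ideal, these are the lattice points
    of its Newton polyhedron. *)
Definition exp_closure E : set 'X_{1..n} :=
  [set m | exists2 k : nat, (0 < k)%N & exp_pow E k (m *+ k)%MM].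

Lemma exp_add_up E F : up_closed F -> up_closed (exp_add E F).
Proof.
move=> uF _ m' [m1 E1 [m2 F2 <-]]; exists m1 => //; exists (m2 + m')%MM.
  exact: uF.
by rewrite addmA.
Qed.

Lemma exp_pow_up E k : up_closed (exp_pow E k).
Proof. by elim: k => [|k IHk] //=; apply: exp_add_up. Qed.

Lemma exp_powD E a b : up_closed E ->
  exp_pow E (a + b) = exp_add (exp_pow E a) (exp_pow E b).
Proof.
move=> uE; elim: a => [|a IHa] /=.
  apply/seteqP; split=> [m Em|_ [m1 _ [m2 Em <-]]].
    by exists 0%MM => //; exists m => //; rewrite add0m.
  by rewrite addmC; apply: exp_pow_up.
rewrite IHa; apply/seteqP; split.
  move=> _ [m1 E1 [_ [m2 E2 [m3 E3 <-]] <-]].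
  by exists (m1 + m2)%MM; [exists m1 => //; exists m2|exists m3 => //; rewrite addmA].
move=> _ [_ [m1 E1 [m2 E2 <-]] [m3 E3 <-]].
by exists m1 => //; exists (m2 + m3)%MM; [exists m2 => //; exists m3|rewrite addmA].
Qed.

Lemma exp_pow_add E a b m1 m2 : up_closed E ->
  exp_pow E a m1 -> exp_pow E b m2 -> exp_pow E (a + b) (m1 + m2)%MM.
Proof. by move=> uE E1 E2; rewrite exp_powD //; exists m1 => //; exists m2. Qed.

Lemma exp_powM E a k : up_closed E -> exp_pow (exp_pow E a) k = exp_pow E (a * k).
Proof.
move=> uE; elim: k => [|k IHk] /=; first by rewrite muln0.
by rewrite mulnS exp_powD // IHk.
Qed.

Lemma exp_pow_muln E a k m : up_closed E ->
  exp_pow E a m -> exp_pow E (a * k) (m *+ k)%MM.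
Proof.
move=> uE Em; elim: k => [|k IHk]; first by rewrite muln0.
by rewrite mulnS mulmS; apply: exp_pow_add.
Qed.

Lemma exp_pow_leq E a b m : up_closed E -> (b <= a)%N ->
  exp_pow E a m -> exp_pow E b m.
Proof.
move=> uE /subnK <-; rewrite addnC exp_powD // => -[m1 E1 [m2 _ <-]].
exact: exp_pow_up.
Qed.

Lemma exp_pow_sub E F k : E `<=` F -> exp_pow E k `<=` exp_pow F k.
Proof.
move=> EF; elim: k => [|k IHk] //= _ [m1 E1 [m2 E2 <-]].
by exists m1; [exact: EF|exists m2 => //; exact: IHk].
Qed.

Lemma exp_closure_up E : up_closed (exp_closure E).
Proof.
move=> m m' [k k0 Em]; exists k => //.
suff -> : ((m + m') *+ k = m *+ k + m' *+ k)%MM by apply: exp_pow_up.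
by apply/mnmP=> i; rewrite !(mnmDE, mulmnE) mulnDl.
Qed.

End ExponentSets.

(** * Monomial ideals *)

Section MonomialIdeals.
Variables (n : nat) (R : comNzRingType).
Implicit Types (E F : set 'X_{1..n}) (m : 'X_{1..n}) (p q : {mpoly R[n]}).

Definition mono_ideal E : set {mpoly R[n]} :=
  [set p | forall m, m \in msupp p -> E m].

Lemma mono_idealX E m : E m -> mono_ideal E 'X_[m].
Proof. by move=> Em m' /mem_msuppXP <-. Qed.

Lemma mono_idealD E p q : mono_ideal E p -> mono_ideal E q -> mono_ideal E (p + q).
Proof.
by move=> Ep Eq m /msuppD_le; rewrite mem_cat => /orP[/Ep|/Eq].
Qed.

Lemma mono_ideal_ideal E : up_closed E -> is_ideal (mono_ideal E).
Proof.
move=> uE; split; [|exact: mono_idealD|].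
  by move=> m; rewrite msupp0.
move=> a p Ep m /msuppM_le /allpairsP[[m1 m2] /= [_ /Ep E2 ->]].
by rewrite addmC; apply: uE.
Qed.

Lemma ideal_scale (P : set {mpoly R[n]}) c p : is_ideal P -> P p -> P (c *: p).
Proof. by move=> [_ _ PM] Pp; rewrite -mul_mpolyC; apply: PM. Qed.

Lemma mono_ideal_min E (P : set {mpoly R[n]}) : is_ideal P ->
  (forall m, E m -> P 'X_[m]) -> mono_ideal E `<=` P.
Proof.
move=> iP EP p Ep; rewrite [p]mpolyE; apply: ideal_sum => // m mp _.
by apply: ideal_scale => //; apply: EP; apply: Ep.
Qed.

Lemma mono_ideal_gen (S : set 'X_{1..n}) :
  ideal_gen [set 'X_[m] | m in S] =
    mono_ideal (exp_add S setT).
Proof.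
have iG := ideal_gen_ideal [set ('X_[m] : {mpoly R[n]}) | m in S].
apply/seteqP; split.
  apply: ideal_gen_min; first by apply: mono_ideal_ideal; apply: exp_add_up.
  move=> _ [m Sm <-]; apply: mono_idealX.
  by exists m => //; exists 0%MM => //; rewrite addm0.
apply: mono_ideal_min => // _ [m1 S1 [m2 _ <-]].
rewrite addmC mpolyXD; have [_ _] := iG; apply; apply: mem_ideal_gen.
by exists m1.
Qed.

Lemma mono_ideal_mul E F : up_closed F ->
  ideal_mul (mono_ideal E) (mono_ideal F) = mono_ideal (exp_add E F).
Proof.
move=> uF; apply/seteqP; split.
  apply: ideal_mul_min; first exact/mono_ideal_ideal/exp_add_up.
  move=> p q Ep Fq m /msuppM_le /allpairsP[[m1 m2] /= [/Ep E1 /Fq F2 ->]].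
  by exists m1 => //; exists m2.
apply: mono_ideal_min; first exact: ideal_gen_ideal.
move=> _ [m1 E1 [m2 F2 <-]]; rewrite mpolyXD.
by apply: ideal_mulP; apply: mono_idealX.
Qed.

Lemma mono_idealT : mono_ideal setT = setT.
Proof. by apply/seteqP. Qed.

Lemma mono_ideal_pow E k : ideal_pow (mono_ideal E) k = mono_ideal (exp_pow E k).
Proof.
elim: k => [|k IHk] /=; first by rewrite mono_idealT.
by rewrite IHk mono_ideal_mul //; apply: exp_pow_up.
Qed.

(** A polynomial supported in a union splits according to which of the two
    sets its monomials lie in. *)
Lemma mono_ideal_add E F :
  ideal_add (mono_ideal E) (mono_ideal F) = mono_ideal (E `|` F).
Proof.
apply/seteqP; split=> [_ [p Ep [q Fq <-]]|p EFp].
  by apply: mono_idealD => m => [/Ep|/Fq]; [left|right].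
pose part (P : pred 'X_{1..n}) := \sum_(m <- msupp p | P m) p@_m *: 'X_[m].
have partP (P : pred 'X_{1..n}) m : m \in msupp (part P) -> P m && (m \in msupp p).
  apply: contraTT; rewrite -mcoeff_eq0 /part -big_filter => Pm.
  rewrite raddf_sum big_seq big1 // => m'; rewrite mem_filter => h.
  rewrite /= mcoeffZ mcoeffX; case: eqP => [e|_]; last by rewrite mulr0.
  by rewrite -e h in Pm.
exists (part (fun m => `[< E m >])) => [m /partP/andP[/asboolP] //|].
exists (part (fun m => ~~ `[< E m >])).
  by move=> m /partP/andP[/asboolP nE /EFp []].
by rewrite [RHS]mpolyE (bigID (fun m => `[< E m >])).
Qed.

Lemma mono_ideal0 : mono_ideal set0 = [set 0].
Proof.
apply/seteqP; split=> [p p0 /=|_ -> m]; last by rewrite msupp0.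
apply: msuppnil0; move: p0; rewrite /mono_ideal /=.
case: (msupp p) => // m r /(_ m (mem_head _ _)) [].
Qed.

End MonomialIdeals.

Arguments mono_ideal {n} R E.
Arguments mono_idealX {n} R {E m} Em : rename.

Lemma bigU_mono_ideal n (R : comNzRingType) k (E : 'I_k -> set 'X_{1..n}) :
  \big[@ideal_add _ / [set 0]]_(i < k) mono_ideal R (E i) =
  mono_ideal R (\bigcup_i E i).
Proof.
elim: k E => [|k IHk] E.
  by rewrite big_ord0 -mono_ideal0; congr mono_ideal; apply/seteqP; split=> // m [[]].
rewrite big_ord_recl IHk mono_ideal_add; congr mono_ideal.
apply/seteqP; split=> m; first by case=> [|[i _]] ?; [exists ord0|exists (lift ord0 i)].
by case=> i _; case: (unliftP ord0 i) => [j|] -> Em; [right; exists j|left].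
Qed.

(** * The integral closure of a monomial ideal *)

Section ClosureLower.
Variables (n : nat) (R : comNzRingType).
Implicit Types (E : set 'X_{1..n}) (m : 'X_{1..n}).

(** If km lies in E^k, then X^m is a root of Y^k - X^(km). *)
Lemma integral_closureX E m : exp_closure E m ->
  integral_closure (mono_ideal R E) 'X_[m].
Proof.
move=> [k k0 Em]; exists k, (fun i => if i == k then - 'X_[m *+ k] else 0).
split=> // [i _|].
  rewrite mono_ideal_pow; case: eqP => [->|_].
    by apply: (idealN (mono_ideal_ideal _ (@exp_pow_up _ E k))); apply: mono_idealX.
  by move=> m'; rewrite msupp0.
rewrite big_nat_recr //= eqxx subnn mulr1 big_nat big1 ?add0r ?mpolyXn ?subrr //.
by move=> i /andP[_ ik]; rewrite ltn_eqF // mul0r.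
Qed.

Lemma mono_ideal_sub_closure E :
  mono_ideal R (exp_closure E) `<=` integral_closure (mono_ideal R E).
Proof.
apply: mono_ideal_min => [|m]; first exact: integral_closure_ideal.
exact: integral_closureX.
Qed.

End ClosureLower.

(** In an integral equation of degree k for cX^m, the monomial X^(km) of (cX^m)^k
    must cancel against some a_i (cX^m)^(k-i) with i >= 1, so that X^(im) occurs
    in a_i, which lies in the i-th power of the ideal. *)
Lemma integral_monomial_exp n (D : idomainType) (E : set 'X_{1..n}) m (c : D) :
  c != 0 -> integral_closure (mono_ideal D E) (c *: 'X_[m]) -> exp_closure E m.
Proof.
move=> c0 [k [a [k0 La e]]].
have [h|h] := pselect (exists2 i, (1 <= i <= k)%N & (a i)@_(m *+ i) != 0).
  have [i ik ai] := h; exists i; first by case/andP: ik.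
  by have := La i ik; rewrite mono_ideal_pow; apply; rewrite mcoeff_msupp.
case/eqP: (expf_neq0 k c0).
rewrite -[RHS](mcoeff0 _ (m *+ k)%MM) -[in RHS]e mcoeffD raddf_sum /=.
rewrite big_nat big1 ?addr0 => [|i ik].
  by rewrite exprZn mpolyXn mcoeffZ mcoeffX eqxx mulr1.
have ai : (a i)@_(m *+ i) = 0.
  by apply/eqP/negP => /negP ai; apply: h; exists i.
have -> : (m *+ k = m *+ (k - i) + m *+ i)%MM.
  by apply/mnmP=> j; rewrite mnmDE !mulmnE -mulnDr subnK //; case/andP: ik.
by rewrite exprZn mpolyXn -scalerAr mcoeffZ mcoeffMX ai mulr0.
Qed.

Section Torus.
Variables (n : nat) (R : idomainType).
Local Notation D := {poly R}.
Implicit Types (E : set 'X_{1..n}) (m : 'X_{1..n}) (f : {mpoly D[n]}).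

(** The substitution of T X_i for X_i, where T is the variable of the coefficient
    ring. Coefficients are taken in [{poly R}] because the powers of T are pairwise
    distinct, whereas a finite field has only finitely many scalars. *)
Definition torus (i : 'I_n) : {rmorphism {mpoly D[n]} -> {mpoly D[n]}} :=
  comp_mpoly [tuple ('X ^+ (j == i) : D) *: 'X_j | j < n].

Lemma torusX i m : torus i 'X_[m] = 'X^(m i) *: 'X_[m].
Proof.
rewrite /torus /= comp_mpolyX.
under eq_bigr do rewrite tnth_mktuple exprZn.
rewrite scaler_prod -mpolyXE_id; congr (_ *: _).
rewrite (bigD1 i) //= eqxx big1 ?mulr1 // => j /negPf ->.
by rewrite expr0 expr1n.
Qed.

Lemma torusZ i c f : torus i (c *: f) = c *: torus i f.
Proof. exact: comp_mpolyZ. Qed.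

Lemma mcoeff_torus i f m : (torus i f)@_m = 'X^(m i) * f@_m.
Proof.
rewrite [in LHS](mpolyE f) rmorph_sum [in RHS](mpolyE f) !raddf_sum mulr_sumr.
apply: eq_bigr => m' _; rewrite torusZ torusX /= !mcoeffZ mcoeffX.
by case: eqP => [->|_]; rewrite ?mulr0 //; ring.
Qed.

Lemma torus_mono_ideal i E f : mono_ideal D E f -> mono_ideal D E (torus i f).
Proof.
move=> Ef m; rewrite mcoeff_msupp mcoeff_torus mulf_eq0 negb_or => /andP[_ fm].
by apply: Ef; rewrite mcoeff_msupp.
Qed.

(** Monomials are eigenvectors of the torus maps, which preserve monomial ideals and
    hence their integral closures. If another monomial m0 occurs in f, choose i
    with m_i <> m0_i: then [torus i f - T^(m0_i) f] is integral, its
    monomials are monomials of f, it has lost m0 and it has kept m. Induction on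
    the number of monomials ends with a nonzero multiple of X^m. *)
Lemma isolate_monomial E f m :
  integral_closure (mono_ideal D E) f -> m \in msupp f ->
  exists2 c : D, c != 0 & integral_closure (mono_ideal D E) (c *: 'X_[m]).
Proof.
have [N] := ubnP (size (msupp f)).
elim: N f => // N IHN f; rewrite ltnS => sN Cf mf.
have iC := integral_closure_ideal (mono_ideal D E).
have [/hasP[m0 m0f m0m]|] := boolP (has (fun m0 => m0 != m) (msupp f)).
  have [i mi] : exists i, m i != m0 i.
    apply: contrapT => h; case/eqP: m0m; apply/mnmP=> i.
    by apply/eqP/negP=> hi; apply: h; exists i; rewrite eq_sym; apply/negP.
  pose g := torus i f + (- 'X^(m0 i) : D) *: f.
  have gE k : g@_k = ('X^(k i) - 'X^(m0 i)) * f@_k.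
    by rewrite mcoeffD mcoeffZ mcoeff_torus mulrBl mulNr.
  apply: (IHN g).
  - apply: leq_trans sN.
    have: (size (m0 :: msupp g) <= size (msupp f))%N => //.
    apply: uniq_leq_size.
      by rewrite /= msupp_uniq -mcoeff_eq0 gE subrr mul0r eqxx.
    move=> k; rewrite inE => /predU1P[->//|].
    by rewrite !mcoeff_msupp gE mulf_eq0 negb_or => /andP[].
  - have [_ CD _] := iC; apply: CD; last exact: ideal_scale.
    by apply: integral_closure_morph Cf => p; apply: torus_mono_ideal.
  rewrite mcoeff_msupp gE mulf_neq0 -?mcoeff_msupp // subr_eq0.
  apply/eqP => /(congr1 (fun p : D => size p)); rewrite !size_polyXn => -[].
  exact/eqP.
move/hasPn => h; exists f@_m; first by rewrite -mcoeff_msupp.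
suff <- : f = f@_m *: 'X_[m] by [].
apply/mpolyP=> k; rewrite mcoeffZ mcoeffX; case: eqP => [<-|km].
  by rewrite mulr1.
rewrite mulr0; apply: memN_msupp_eq0; apply/negP => /h; rewrite negbK => /eqP.
by move=> e; apply: km.
Qed.

End Torus.

(** Over a domain, the integral closure of a monomial ideal is monomial. The
    coefficients are first extended from [R] to [{poly R}], where the monomials of
    an integral element can be isolated. *)
Lemma integral_closure_mono_ideal n (R : idomainType) (E : set 'X_{1..n}) :
  integral_closure (mono_ideal R E) = mono_ideal R (exp_closure E).
Proof.
apply/seteqP; split; last exact: mono_ideal_sub_closure.
move=> f Cf m mf.
pose g : {mpoly {poly R}[n]} := map_mpoly polyC f.
have Cg : integral_closure (mono_ideal {poly R} E) g.
  apply: (integral_closure_morph (f := map_mpoly polyC)) Cf => p Ep k.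
  by rewrite mcoeff_msupp mcoeff_map_mpoly /= polyC_eq0 -mcoeff_msupp; apply: Ep.
have mg : m \in msupp g.
  by rewrite mcoeff_msupp mcoeff_map_mpoly /= polyC_eq0 -mcoeff_msupp.
have [c c0 Cc] := isolate_monomial Cg mg.
exact: integral_monomial_exp Cc.
Qed.

(** * Minimal primes and normal torsion-freeness *)

Section VariablePrimes.
Variables (n : nat) (R : idomainType).
Implicit Types (E : set 'X_{1..n}) (m : 'X_{1..n}) (V : pred 'I_n).

Definition deg_in V m := (\sum_(i | V i) m i)%N.

Definition var_exp V : set 'X_{1..n} := [set m | (0 < deg_in V m)%N].

Lemma deg_inD V m1 m2 : deg_in V (m1 + m2)%MM = (deg_in V m1 + deg_in V m2)%N.
Proof. by rewrite -big_split; apply: eq_bigr => i _; rewrite mnmDE. Qed.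

Lemma deg_inMn V m k : deg_in V (m *+ k)%MM = (deg_in V m * k)%N.
Proof. by rewrite /deg_in big_distrl; apply: eq_bigr => i _; rewrite mulmnE. Qed.

Lemma deg_in_gt0 V m : (0 < deg_in V m)%N -> exists2 i, V i & (U_(i) <= m)%MM.
Proof.
rewrite lt0n sum_nat_eq0 negb_forall => /existsP[i]; rewrite negb_imply => /andP[Vi mi].
by exists i => //; rewrite lep1mP.
Qed.

Lemma deg_inU V i : V i -> deg_in V U_(i)%MM = 1%N.
Proof.
move=> Vi; rewrite /deg_in (bigD1 i) //= mnm1E eqxx big1 // => j /andP[_ ji].
by rewrite mnm1E eq_sym (negPf ji).
Qed.

Lemma var_exp_up V : up_closed (var_exp V).
Proof. by move=> m m' h; rewrite /var_exp /= deg_inD ltn_addr. Qed.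

Lemma exp_pow_var V c : exp_pow (var_exp V) c = [set m | (c <= deg_in V m)%N].
Proof.
elim: c => [|c IHc] /=; first by apply/seteqP.
rewrite IHc; apply/seteqP; split=> [_ [m1 h1 [m2 h2 <-]]|m /= cm].
  by rewrite /= deg_inD -add1n leq_add.
have [i Vi im] := deg_in_gt0 (leq_ltn_trans (leq0n c) cm).
exists U_(i)%MM; first by rewrite /var_exp /= deg_inU.
exists (m - U_(i))%MM; last by rewrite addmC submK.
by move: cm; rewrite -{1}(submK im) deg_inD deg_inU // addn1.
Qed.

(** Its kernel is the ideal generated by the variables of [V], and its values
    lie in a domain, whence the primality of that ideal. *)
Definition kill_vars V : {rmorphism {mpoly R[n]} -> {mpoly R[n]}} :=
  comp_mpoly [tuple if V i then 0 else 'X_i | i < n].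

Lemma kill_varsZ V c p : kill_vars V (c *: p) = c *: kill_vars V p.
Proof. exact: comp_mpolyZ. Qed.

Lemma kill_varsX V m :
  kill_vars V 'X_[m] = if (0 < deg_in V m)%N then 0 else 'X_[m].
Proof.
rewrite /kill_vars /= comp_mpolyX; under eq_bigr do rewrite tnth_mktuple.
case: ifP => [/deg_in_gt0[i Vi]|/negbT].
  by rewrite lep1mP => mi; rewrite (bigD1 i) //= Vi expr0n (negPf mi) mul0r.
rewrite -eqn0Ngt sum_nat_eq0 => /forall_inP mV.
rewrite mpolyXE_id; apply: eq_bigr => i _; case: ifP => // Vi.
by rewrite (eqP (mV i Vi)) !expr0.
Qed.

Lemma kill_vars_eq0 V p : kill_vars V p = 0 <-> mono_ideal R (var_exp V) p.
Proof.
split=> [kp m mp|Vp]; last first.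
  rewrite (mpolyE p) rmorph_sum big_seq big1 // => m mp.
  by rewrite kill_varsZ kill_varsX (Vp _ mp) scaler0.
apply: contraT => Vm.
have: (kill_vars V p)@_m = 0 by rewrite kp mcoeff0.
suff -> : (kill_vars V p)@_m = p@_m by move/eqP; rewrite mcoeff_eq0 mp.
rewrite [in LHS](mpolyE p) rmorph_sum [in RHS](mpolyE p) !raddf_sum.
apply: eq_bigr => m' _; rewrite kill_varsZ kill_varsX /=.
case: ifP => // Vm'; rewrite scaler0 mcoeff0 mcoeffZ mcoeffX.
by case: eqP => [e|_]; [rewrite -e Vm' in Vm|rewrite mulr0].
Qed.

Lemma var_prime V : is_prime_ideal (mono_ideal R (var_exp V)).
Proof.
split; first exact/mono_ideal_ideal/var_exp_up.
  by move/kill_vars_eq0 => /eqP; rewrite rmorph1 oner_eq0.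
move=> p q /kill_vars_eq0; rewrite rmorphM => /eqP; rewrite mulf_eq0.
by case/orP=> /eqP /kill_vars_eq0; [left|right].
Qed.

Lemma prime_monomial (P : set {mpoly R[n]}) m : is_prime_ideal P -> P 'X_[m] ->
  exists2 i, P 'X_i & (U_(i) <= m)%MM.
Proof.
move=> [_ P1 PM] Pm; apply: contrapT => h; suff: ~ P 'X_[m] by apply.
rewrite mpolyXE_id; apply: (big_ind (fun x => ~ P x)) => // [x y nx ny /PM[]//|i _].
have [->|mi] := eqVneq (m i) 0%N; first by rewrite expr0.
have Pi : ~ P 'X_i by move=> Pi; apply: h; exists i => //; rewrite lep1mP.
elim: (m i) => [|k IHk]; first by rewrite expr0.
by rewrite exprS => /PM[].
Qed.

(** Each monomial of the ideal lies in P, hence so does one of its variables. The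
    ideal generated by the variables of P is thus a prime between the monomial
    ideal and P, and minimality of P makes it equal to P. *)
Lemma minimal_primes_mono_ideal E P : minimal_primes (mono_ideal R E) P ->
  exists V, P = mono_ideal R (var_exp V).
Proof.
move=> [pP EP minP]; have [iP _ _] := pP.
pose V i := `[< P 'X_i >]; exists V; apply/esym/minP; first exact: var_prime.
  move=> p Ep m mp.
  have [i Pi im] := prime_monomial pP (EP _ (mono_idealX R (Ep m mp))).
  rewrite /var_exp /= /deg_in (bigD1 i) /=; last exact/asboolP.
  by rewrite addn_gt0 lt0n -lep1mP im.
apply: mono_ideal_min => // m /deg_in_gt0[i /asboolP Pi im].
by rewrite -(submK im) mpolyXD; have [_ _] := iP; apply.
Qed.

(** The condition on [c] says that c is at most the ceiling of i/k. If P is a minimal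
    prime, generated by the variables of V, then X^(ka) in P^i means
    k deg_V(a) >= i, whence deg_V(a) >= c, that is, X^a lies in P^c. So X^a lies in
    the c-th symbolic power, which is the c-th power. *)
Lemma normally_torsion_free_exp E a k i c :
  normally_torsion_free (mono_ideal R E) ->
  exp_pow E i (a *+ k)%MM -> (c * k < i + k)%N -> exp_pow E c a.
Proof.
case: c => // c ntf Ei ck.
suff: ideal_pow (mono_ideal R E) c.+1 'X_[a].
  by rewrite mono_ideal_pow; apply; rewrite msuppX mem_head.
rewrite -ntf // => P minP; have [V PV] := minimal_primes_mono_ideal minP.
have [_ EP _] := minP; rewrite PV in EP *.
rewrite mono_ideal_pow exp_pow_var; apply: mono_idealX => /=.
have: exp_pow (var_exp V) i (a *+ k)%MM.
  apply: exp_pow_sub Ei => m Em.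
  by have := EP _ (mono_idealX R Em); apply; rewrite msuppX mem_head.
rewrite exp_pow_var /= deg_inMn; nia.
Qed.

End VariablePrimes.

(** * Adding variables *)

Section VariableInclusion.
Variables (R : comNzRingType) (s N : nat) (sigma : 'I_s -> 'I_N).
Hypothesis sigma_inj : injective sigma.
Implicit Types (E : set 'X_{1..s}) (m : 'X_{1..N}).

Definition mnm_res m : 'X_{1..s} := [multinom m (sigma i) | i < s].

Definition mnm_ext (a : 'X_{1..s}) : 'X_{1..N} :=
  [multinom (\sum_(i | sigma i == j) a i)%N | j < N].

Lemma mnm_resD m1 m2 : mnm_res (m1 + m2)%MM = (mnm_res m1 + mnm_res m2)%MM.
Proof. by apply/mnmP=> i; rewrite !(mnmE, mnmDE). Qed.

Lemma mnm_resMn m k : mnm_res (m *+ k)%MM = (mnm_res m *+ k)%MM.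
Proof. by apply/mnmP=> i; rewrite !(mnmE, mulmnE). Qed.

Lemma mnm_extK : cancel mnm_ext mnm_res.
Proof.
move=> a; apply/mnmP=> i; rewrite !mnmE (big_pred1 i) // => j.
exact: inj_eq.
Qed.

Lemma mnm_ext_le a m : (a <= mnm_res m)%MM -> (mnm_ext a <= m)%MM.
Proof.
move=> /mnm_lepP am; apply/mnm_lepP=> j; rewrite mnmE.
have [[i ij]|h] := pselect (exists i, sigma i = j).
  by rewrite -ij (big_pred1 i) => [|i']; rewrite ?inj_eq //; have := am i; rewrite mnmE.
by rewrite big_pred0 // => i; apply/eqP => ij; apply: h; exists i.
Qed.

Lemma up_closed_res E : up_closed E -> up_closed (mnm_res @^-1` E).
Proof. by move=> uE m m' Em; rewrite /preimage /= mnm_resD; apply: uE. Qed.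

Lemma exp_pow_res E k :
  exp_pow (mnm_res @^-1` E) k = mnm_res @^-1` (exp_pow E k).
Proof.
elim: k => // k IHk; apply/seteqP; split=> /= m; rewrite IHk.
  move=> [m1 E1 [m2 E2 <-]]; rewrite /preimage /= mnm_resD.
  by exists (mnm_res m1) => //; exists (mnm_res m2).
move=> [a Ea [b Eb ab]].
have am : (mnm_ext a <= m)%MM by apply: mnm_ext_le; rewrite -ab lem_addr.
exists (mnm_ext a); first by rewrite /preimage /= mnm_extK.
exists (m - mnm_ext a)%MM; last by rewrite addmC submK.
suff e : mnm_res (m - mnm_ext a)%MM = b by rewrite /preimage /= e.
apply: (@addmI _ a); rewrite ab -[in RHS](submK am) mnm_resD mnm_extK addmC //.
Qed.

Lemma extend_mono_ideal E : up_closed E ->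
  ideal_gen [set p \mPo [tuple ('X_(sigma i) : {mpoly R[N]}) | i < s] |
             p in mono_ideal R E]
  = mono_ideal R (mnm_res @^-1` E).
Proof.
move=> uE.
have extX a : 'X_[a] \mPo [tuple ('X_(sigma i) : {mpoly R[N]}) | i < s] =
    'X_[mnm_ext a].
  rewrite comp_mpolyX; under eq_bigr do rewrite tnth_mktuple.
  rewrite mprodXnE; congr mpolyX; apply/mnmP=> j; rewrite mnm_sumE mnmE [RHS]big_mkcond.
  by apply: eq_bigr => i _; rewrite mulmnE mnm1E; case: eqP; rewrite ?mul1n ?mul0n.
have iE := mono_ideal_ideal R (up_closed_res uE).
apply/seteqP; split.
  apply: ideal_gen_min => // _ [p Ep <-].
  rewrite (mpolyE p) raddf_sum; apply: ideal_sum => // a ap _ /=.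
  rewrite comp_mpolyZ extX; apply: (ideal_scale _ iE); apply: mono_idealX.
  by rewrite /preimage /= mnm_extK; apply: Ep.
apply: mono_ideal_min => [|m Em]; first exact: ideal_gen_ideal.
have mm : (mnm_ext (mnm_res m) <= m)%MM by apply: mnm_ext_le; apply: lepm_refl.
rewrite -(submK mm) mpolyXD; have [_ _] := ideal_gen_ideal
  [set p \mPo [tuple ('X_(sigma i) : {mpoly R[N]}) | i < s] | p in mono_ideal R E].
apply; apply: mem_ideal_gen; exists 'X_[mnm_res m]; last exact: extX.
exact: mono_idealX.
Qed.

End VariableInclusion.

(** * Two disjoint blocks of variables *)

(** The exponents version of (I + J)^N = sum of the I^i J^(N-i). *)
Lemma exp_pow_setU n (E F : set 'X_{1..n}) N m : exp_pow (E `|` F) N m ->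
  exists i m1 m2,
    [/\ (i <= N)%N, exp_pow E i m1, exp_pow F (N - i) m2 & m = (m1 + m2)%MM].
Proof.
elim: N m => [|N IHN] m /=.
  by move=> _; exists 0%N, 0%MM, m; split=> //; rewrite add0m.
move=> [u EFu [v /IHN[i [m1 [m2 [iN E1 F2 ->]]]] <-]]; case: EFu => [Eu|Fu].
  exists i.+1, (u + m1)%MM, m2; split=> //; last by rewrite addmA.
  by exists u => //; exists m1.
exists i, m1, (u + m2)%MM; split=> //; first exact: leqW.
  by rewrite subSn //; exists u => //; exists m2.
by rewrite !addmA (addmC u).
Qed.

Section TwoBlocks.
Variables (s t : nat).
Implicit Types (E : set 'X_{1..s}) (F : set 'X_{1..t}) (m : 'X_{1..s + t}).
Local Notation resA := (mnm_res (@lshift s t)).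
Local Notation resB := (mnm_res (@rshift s t)).

(** For ideals in disjoint sets of variables, product and intersection agree. *)
Lemma exp_add_blocks E F : up_closed E -> up_closed F ->
  exp_add (resA @^-1` E) (resB @^-1` F) = (resA @^-1` E) `&` (resB @^-1` F).
Proof.
move=> uE uF; apply/seteqP; split=> [_ [m1 E1 [m2 F2 <-]]|m [Em Fm]].
  split; rewrite /preimage /= mnm_resD; first exact: uE.
  by rewrite addmC; apply: uF.
have am : (mnm_ext (@lshift s t) (resA m) <= m)%MM.
  by apply: mnm_ext_le; [exact: lshift_inj|exact: lepm_refl].
exists (mnm_ext (@lshift s t) (resA m)).
  by rewrite /preimage /= mnm_extK //; exact: lshift_inj.
exists (m - mnm_ext (@lshift s t) (resA m))%MM; last by rewrite addmC submK.
suff e : resB (m - mnm_ext (@lshift s t) (resA m))%MM = resB m.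
  by rewrite /preimage /= e.
apply/mnmP=> j; rewrite !(mnmE, mnmBE) big_pred0 ?subn0 // => i.
by rewrite eq_lrshift.
Qed.

(** From left to right, suppose km = m1 + m2 with m1 in the exponents of I^i and m2
    in those of J^(nk-i), and let (a, b) be the two blocks of m. Then ka lies in I^i
    and kb in J^(nk-i). For c the ceiling of i/k, a lies in I^c by normal
    torsion-freeness, and kb lies in J^(k(n-c)) since i <= ck. From right to left,
    multiply by the k that witnesses that b lies in the closure of J^(n-i). *)
Lemma exp_closure_blocks (K : idomainType) E F n : up_closed E -> up_closed F ->
  normally_torsion_free (mono_ideal K E) ->
  exp_closure (exp_pow ((resA @^-1` E) `|` (resB @^-1` F)) n) =
  \bigcup_(i : 'I_n.+1) exp_add (resA @^-1` (exp_pow E i))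
                        (resB @^-1` (exp_closure (exp_pow F (n - i)))).
Proof.
move=> uE uF ntf; have uA := up_closed_res (sigma := @lshift s t) uE.
have uB := up_closed_res (sigma := @rshift s t) uF.
set U := _ `|` _; have uU : up_closed U.
  by move=> m m' [?|?]; [left; apply: uA|right; apply: uB].
apply/seteqP; split=> [m [k k0]|m [i _]]; rewrite ?exp_powM //.
  move=> /exp_pow_setU[i [m1 [m2 [ink E1 F2 mE]]]].
  have Ai : exp_pow E i (resA m *+ k)%MM.
    rewrite -mnm_resMn mE; suff: exp_pow (resA @^-1` E) i (m1 + m2)%MM.
      by rewrite exp_pow_res //; exact: lshift_inj.
    exact: exp_pow_up.
  have Bi : exp_pow F (n * k - i) (resB m *+ k)%MM.
    rewrite -mnm_resMn mE; suff: exp_pow (resB @^-1` F) (n * k - i) (m1 + m2)%MM.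
      by rewrite exp_pow_res //; exact: rshift_inj.
    by rewrite addmC; apply: exp_pow_up.
  (* the ceiling of i / k *)
  pose c := ((i + k.-1) %/ k)%N.
  have ck : (c * k < i + k)%N.
    by have := leq_divM (i + k.-1) k; rewrite -/c; lia.
  have ic : (i <= c * k)%N.
    by have := ltn_ceil (i + k.-1) k0; rewrite -/c; lia.
  have cn : (c < n.+1)%N by nia.
  exists (Ordinal cn) => //=; rewrite exp_add_blocks.
  - split; first exact: normally_torsion_free_exp ntf Ai ck.
    by exists k => //; rewrite exp_powM //; apply: exp_pow_leq Bi => //; nia.
  - exact: exp_pow_up.
  - exact: exp_closure_up.
rewrite exp_add_blocks; [|exact: exp_pow_up|exact: exp_closure_up].
move=> [Em [k k0]]; rewrite exp_powM // => Fm.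
exists k => //; rewrite exp_powM //.
have: exp_add (exp_pow (resA @^-1` E) (i * k))
              (exp_pow (resB @^-1` F) ((n - i) * k)) (m *+ k)%MM.
  rewrite !exp_pow_res; [|exact: rshift_inj|exact: lshift_inj].
  rewrite exp_add_blocks; [|exact: exp_pow_up|exact: exp_pow_up].
  split; rewrite /preimage /= mnm_resMn //; exact: exp_pow_muln.
move=> [m1 E1 [m2 F2 <-]].
rewrite -(subnKC (ltn_ord i : (i <= n)%N)) mulnDl.
apply: exp_pow_add => //.
  by apply: exp_pow_sub E1 => x; left.
by apply: exp_pow_sub F2 => x; right.
Qed.

End TwoBlocks.

Theorem theorem2p1 (K : fieldType) (s t : nat)
    (I : set {mpoly K[s]}) (J : set {mpoly K[t]})
    (hI : squarefree_monomial_ideal I) (hJ : monomial_ideal J)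
    (hItf : normally_torsion_free I) (n : nat) (hn : (1 <= n)%N) :
  integral_closure (ideal_pow (ideal_add (extA t I) (extB s J)) n) =
  \big[@ideal_add _ / [set 0]]_(i < n.+1)
    ideal_mul (extA t (ideal_pow I i))
              (extB s (integral_closure (ideal_pow J (n - i)))).
Proof.
case: hI hJ => [S [_ IE]] [T JE]; move: IE JE; rewrite !mono_ideal_gen.
have: up_closed (exp_add S setT) by apply: exp_add_up.
have: up_closed (exp_add T setT) by apply: exp_add_up.
move: (exp_add S _) (exp_add T _) => E F uF uE IE JE; subst I J.
have extAE G : up_closed G -> extA t (mono_ideal K G) =
    mono_ideal K (mnm_res (@lshift s t) @^-1` G).
  exact/extend_mono_ideal/lshift_inj.
have extBE G : up_closed G -> extB s (mono_ideal K G) =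
    mono_ideal K (mnm_res (@rshift s t) @^-1` G).
  exact/extend_mono_ideal/rshift_inj.
rewrite extAE // extBE // mono_ideal_add mono_ideal_pow integral_closure_mono_ideal.
rewrite (exp_closure_blocks n uE uF hItf) -bigU_mono_ideal; apply: eq_bigr => i _.
rewrite !mono_ideal_pow integral_closure_mono_ideal.
rewrite extAE ?extBE ?mono_ideal_mul //; [|exact: exp_closure_up|exact: exp_pow_up].
exact: (up_closed_res (@exp_closure_up _ _)).
Qed.
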